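(* Let $L_1$ be the 3-dimensional complex $\omega$-Lie algebra with basis $\{x,y,z\}$, bracket determined by $[x,z]=0$, $[y,z]=z$, $[x,y]=y$, and form $\omega$ determined by $\omega(y,z)=\omega(x,z)=0$, $\omega(x,y)=1$. Then: (1) $\mathrm{Aut}(L_1)$ is a matrix Lie group. (2) $\mathrm{Aut}(L_1)=\exp(\mathrm{Der}(L_1))$, where $\exp$ denotes the matrix exponential. (3) $\mathrm{Aut}(L_1)$ is a connected Lie group, i.e., it is path-connected as a topological space. (4) $\mathrm{Aut}(L_1)$ is a soluble Lie group.
   Context: An $\omega$-Lie algebra over $\mathbb{C}$ is a triple $(\mathfrak{g},[-,-],\omega)$ where $\mathfrak{g}$ is a finite-dimensional complex vector space, $[-,-]$ is a skew-symmetric bilinear bracket on $\mathfrak{g}$ and $\omega:\mathfrak{g}\times\mathfrak{g}\to\mathbb{C}$ is a skew-symmetric bilinear form such that $$[[x,y],z]+[[y,z],x]+[[z,x],y]=\omega(x,y)z+\omega(y,z)x+\omega(z,x)y$$ for all $x,y,z\in\mathfrak{g}$. $\mathrm{Der}(\mathfrak{g})$ is the Lie algebra of all linear maps $d:\mathfrak{g}\to\mathfrak{g}$ with $d([x,y])=[d(x),y]+[x,d(y)]$ for all $x,y\in\mathfrak{g}$. $\mathrm{Aut}(\mathfrak{g})$ is the group of all linear isomorphisms $\rho:\mathfrak{g}\to\mathfrak{g}$ with $\rho([x,y])=[\rho(x),\rho(y)]$ for all $x,y\in\mathfrak{g}$. Using the given basis, linear maps of $L_1$ are identified with $3\times 3$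 complex matrices, so $\mathrm{Der}(L_1)\subseteq\mathfrak{gl}_3(\mathbb{C})$ and $\mathrm{Aut}(L_1)\subseteq\mathrm{GL}(3,\mathbb{C})$; $\exp(X)=\sum_{k\ge 0}X^k/k!$ and $\exp(\mathrm{Der}(L_1))=\{\exp(d)\mid d\in\mathrm{Der}(L_1)\}$. A matrix Lie group is a closed subgroup of a general linear group $\mathrm{GL}(n,\mathbb{C})$. *)

(* Defs.v *)
From HB Require Import structures.
From mathcomp Require Import all_boot all_order all_algebra.
From mathcomp Require Import all_classical all_reals all_analysis.
From mathcomp Require Import complex ring.

Set Implicit Arguments.
Unset Strict Implicit.
Unset Printing Implicit Defensive.

Import Order.TTheory GRing.Theory Num.Theory.
Import numFieldNormedType.Exports.
Local Open Scope classical_set_scope.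
Local Open Scope ring_scope.

(* By skew-symmetry, linearity in the second argument is enough for
   bilinearity. *)
Record omegaLieAlgebra (K : fieldType) := OmegaLieAlgebra {
  carrier :> vectType K ;
  bracket : carrier -> carrier -> carrier ;
  omega : carrier -> carrier -> K ;
  bracket_linear : forall u, linear (bracket u) ;
  bracket_skew : forall u v, bracket u v = - bracket v u ;
  omega_linear : forall u, scalar (omega u) ;
  omega_skew : forall u v, omega u v = - omega v u ;
  omega_jacobi : forall u v w,
    bracket (bracket u v) w + bracket (bracket v w) u + bracket (bracket w u) v
    = omega u v *: w + omega v w *: u + omega w u *: v }.

Section Morphisms.
Variables (K : fieldType) (g : omegaLieAlgebra K).

Definition Der : set 'End(g) :=
  [set d | forall u v, d (bracket u v) = bracket (d u) v + bracket u (d v)].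

Definition Aut : set 'End(g) :=
  [set rho : 'End(g) | bijective rho /\
    forall u v, rho (bracket u v) = bracket (rho u) (rho v)].

(* Column j holds the coordinates of f e_j, so that composition of maps is
   the matrix product (the vector library's [mxof] is the transpose). *)
Definition mx_of n (e : n.-tuple g) (f : 'End(g)) : 'M[K]_n :=
  \matrix_(i, j) coord e i (f e`_j).

Definition Der_mx n (e : n.-tuple g) : set 'M[K]_n := mx_of e @` Der.
Definition Aut_mx n (e : n.-tuple g) : set 'M[K]_n := mx_of e @` Aut.

End Morphisms.

(* On K^3 with x, y, z the standard basis vectors, the brackets [x,y] = y,
   [y,z] = z, [x,z] = 0 and the form omega(x,y) = 1,
   omega(y,z) = omega(x,z) = 0 are extended bilinearly and skew-symmetrically;
   see the lemmas L1_xy to L1_omega_xz. *)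
Section L1.
Variable K : fieldType.
Implicit Types u v w : 'cV[K]_3.

Let i0 : 'I_3 := @Ordinal 3 0 isT.
Let i1 : 'I_3 := @Ordinal 3 1 isT.
Let i2 : 'I_3 := @Ordinal 3 2 isT.

Definition L1_x : 'cV[K]_3 := delta_mx i0 0.
Definition L1_y : 'cV[K]_3 := delta_mx i1 0.
Definition L1_z : 'cV[K]_3 := delta_mx i2 0.

Definition L1_bracket u v : 'cV[K]_3 :=
  (u i0 0 * v i1 0 - u i1 0 * v i0 0) *: L1_y +
  (u i1 0 * v i2 0 - u i2 0 * v i1 0) *: L1_z.

Definition L1_omega u v : K := u i0 0 * v i1 0 - u i1 0 * v i0 0.

Let col3P u v :
  u i0 0 = v i0 0 -> u i1 0 = v i1 0 -> u i2 0 = v i2 0 -> u = v.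
Proof.
move=> h0 h1 h2; apply/matrixP => i j; rewrite (ord1 j).
case: i => [[|[|[|//]]] hi].
- by rewrite (_ : Ordinal hi = i0) //; apply: val_inj.
- by rewrite (_ : Ordinal hi = i1) //; apply: val_inj.
- by rewrite (_ : Ordinal hi = i2) //; apply: val_inj.
Qed.

Let col3E := (mxE, mulr1n, mulr0n, mulr1, mulr0, add0r, addr0).

Fact L1_bracket_linear u : linear (L1_bracket u).
Proof. by move=> a v w; apply: col3P; rewrite !col3E /=; ring. Qed.

Fact L1_bracket_skew u v : L1_bracket u v = - L1_bracket v u.
Proof. by apply: col3P; rewrite !col3E /=; ring. Qed.

Fact L1_omega_linear u : scalar (L1_omega u).
Proof. by move=> a v w; rewrite /L1_omega !mxE /=; ring. Qed.

Fact L1_omega_skew u v : L1_omega u v = - L1_omega v u.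
Proof. by rewrite /L1_omega; ring. Qed.

Fact L1_jacobi u v w :
  L1_bracket (L1_bracket u v) w + L1_bracket (L1_bracket v w) u
    + L1_bracket (L1_bracket w u) v
  = L1_omega u v *: w + L1_omega v w *: u + L1_omega w u *: v.
Proof. by rewrite /L1_omega; apply: col3P; rewrite !col3E /=; ring. Qed.

Definition L1 : omegaLieAlgebra K :=
  OmegaLieAlgebra L1_bracket_linear L1_bracket_skew
    L1_omega_linear L1_omega_skew L1_jacobi.

Definition L1_basis : 3.-tuple L1 := [tuple L1_x; L1_y; L1_z].

Lemma L1_xy : bracket (L1_x : L1) L1_y = L1_y.
Proof. by apply: col3P; rewrite !col3E /=; ring. Qed.

Lemma L1_yz : bracket (L1_y : L1) L1_z = L1_z.
Proof. by apply: col3P; rewrite !col3E /=; ring. Qed.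

Lemma L1_xz : bracket (L1_x : L1) L1_z = 0.
Proof. by apply: col3P; rewrite !col3E /=; ring. Qed.

Lemma L1_omega_xy : omega (L1_x : L1) L1_y = 1.
Proof. by rewrite /= /L1_omega !mxE /=; ring. Qed.

Lemma L1_omega_yz : omega (L1_y : L1) L1_z = 0.
Proof. by rewrite /= /L1_omega !mxE /=; ring. Qed.

Lemma L1_omega_xz : omega (L1_x : L1) L1_z = 0.
Proof. by rewrite /= /L1_omega !mxE /=; ring. Qed.

Lemma L1_basisP : basis_of fullv L1_basis.
Proof.
rewrite basisEdim dimvf size_tuple dim_matrix leqnn andbT.
apply/subvP => v _.
have -> : v = v i0 0 *: L1_x + v i1 0 *: L1_y + v i2 0 *: L1_z.
  by apply: col3P; rewrite !col3E.
by rewrite !rpredD // rpredZ // memv_span // !inE eqxx ?orbT.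
Qed.

End L1.

(* The topology on 'M[K]_n is that of entrywise convergence. *)
Section MatrixGroups.
Variables (K : numFieldType) (n : nat).
Implicit Types G : set 'M[K]_n.

Definition GL : set 'M[K]_n := [set A | A \in unitmx].

Definition subgroup_GL G : Prop :=
  [/\ G `<=` GL, G 1%:M,
      (forall A B, G A -> G B -> G (A *m B)) &
      (forall A, G A -> G (invmx A))].

(* "Closed" is relative to GL, which is not closed in 'M[K]_n. *)
Definition matrix_Lie_group G : Prop :=
  subgroup_GL G /\ exists2 F : set 'M[K]_n, closed F & G = GL `&` F.

Definition expmx (X : 'M[K]_n) : 'M[K]_n :=
  lim (series (fun k => k`!%:R^-1 *: X ^+ k) @ \oo).

Definition commutators G : set 'M[K]_n :=
  [set A *m B *m invmx A *m invmx B | A in G & B in G].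

Definition derived_subgroup G : set 'M[K]_n :=
  smallest subgroup_GL (commutators G).

Definition soluble G : Prop :=
  exists m, iter m derived_subgroup G = [set 1%:M].

Definition path_connected (R : realType) G : Prop :=
  forall A B, G A -> G B ->
  exists gamma : R -> 'M[K]_n,
    [/\ {within `[0, 1], continuous gamma}, gamma 0 = A, gamma 1 = B &
        forall t, 0 <= t <= 1 -> G (gamma t)].

End MatrixGroups.

(* Main.v *)
Require Import Defs.
From mathcomp Require Import all_boot all_order all_algebra.
From mathcomp Require Import all_classical all_reals all_analysis.
From mathcomp Require Import complex ring.
Import numFieldNormedType.Exports.
Import Order.TTheory GRing.Theory Num.Theory.
Local Open Scope classical_set_scope.
Local Open Scope ring_scope.
Set Implicit Arguments.
Unset Strict Implicit.
Unset Printing Implicit Defensive.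

(** Testing the defining identities on pairs of basis vectors determines both
    sides of the statement explicitly. A derivation sends x to c z, y to - c z
    and z to k z, so that its matrix [derL1 c k] has third row (c, - c, k) and
    two zero rows (lemma [Der_L1]); an automorphism is a matrix [autL1 c k],
    the identity with its third row replaced by (c, - c, k), where k is nonzero
    (lemma [Aut_L1]). Thus Aut(L_1) is the affine group of the complex line,
    with product (c, k) (c', k') = (c + k c', k k').

    The linear equations on the entries show that this group is closed in GL.
    Its commutators have k = 1, and the elements with k = 1 commute; so the
    second derived subgroup is trivial (lemma [soluble_autL1]).

    For the exponential, X = [derL1 c k] satisfies X ^ 2 = k X, and the
    exponential series of such a matrix collapses to 1 + q X, where
    q = (e ^ k - 1) / k, or q = 1 when k = 0 (lemma [expmx_quasi_idem]). Hence
    exp [derL1 c k] = [autL1 (q c) (e ^ k)]. This is always an automorphism,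
    and every automorphism is obtained, because each nonzero complex number has
    a logarithm at which q does not vanish: q vanishes only at the nonzero
    periods of the exponential, which are logarithms of 1, and for 1 the
    logarithm 0 is available (lemma [cexp_surj_quot]).

    All this needs the sum of the complex exponential series in closed form,
    e ^ (u + i v) = e ^ u (cos v + i sin v). The real and imaginary parts of
    the series for t (u + i v) are real power series f and g in t, with
    f' = u f - v g and g' = v f + u g; this linear system determines them
    (lemma [rotation_scaling_ode]). Polar coordinates then give the surjectivity
    onto the nonzero complex numbers, and also the connectedness: two
    automorphisms are joined by moving c along a segment and k along the image
    of a segment of logarithms. *)

(** * Derivations and automorphisms as matrices *)

Section Algebra.
Variable K : fieldType.
Implicit Types (c k : K) (M : 'M[K]_3).

Definition i0 : 'I_3 := @Ordinal 3 0 isT.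
Definition i1 : 'I_3 := @Ordinal 3 1 isT.
Definition i2 : 'I_3 := @Ordinal 3 2 isT.

Lemma ord3P (P : 'I_3 -> Prop) : P i0 -> P i1 -> P i2 -> forall i, P i.
Proof.
move=> p0 p1 p2 [[|[|[|//]]] hi].
- by rewrite (_ : Ordinal hi = i0) //; apply: val_inj.
- by rewrite (_ : Ordinal hi = i1) //; apply: val_inj.
- by rewrite (_ : Ordinal hi = i2) //; apply: val_inj.
Qed.

Lemma big_ord3 (V : nmodType) (F : 'I_3 -> V) :
  \sum_i F i = F i0 + F i1 + F i2.
Proof.
rewrite !big_ord_recl big_ord0 addr0 addrA.
by congr (F _ + F _ + F _); apply: val_inj.
Qed.

(** The matrix with two zero rows and third row (c, - c, k). *)
Definition derL1 c k : 'M[K]_3 :=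
  c *: (delta_mx i2 i0 - delta_mx i2 i1) + k *: delta_mx i2 i2.

(** The identity matrix with its third row replaced by (c, - c, k). *)
Definition autL1 c k : 'M[K]_3 := 1%:M + derL1 c (k - 1).

Definition autL1_set : set 'M[K]_3 :=
  [set autL1 p.1 p.2 | p in [set p | p.2 != 0]].

Lemma derL1D c k c' k' : derL1 c k + derL1 c' k' = derL1 (c + c') (k + k').
Proof. by rewrite /derL1 !scalerDl addrACA. Qed.

Lemma derL1Z a c k : a *: derL1 c k = derL1 (a * c) (a * k).
Proof. by rewrite /derL1 scalerDr !scalerA. Qed.

(** Only the third row of the left factor is nonzero, and the right factor sees
    only the last entry of it. Both the group law of the automorphisms and the
    collapse of the exponential series come from this identity. *)
Lemma derL1M c k c' k' : derL1 c k *m derL1 c' k' = k *: derL1 c' k'.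
Proof.
rewrite {1}/derL1 mulmxDl -!scalemxAl mulmxBl.
suff E i : delta_mx i2 i *m derL1 c' k' = (i == i2)%:R *: derL1 c' k'.
  by rewrite !E !scale0r subrr scaler0 add0r scale1r.
rewrite /derL1 mulmxDr -!scalemxAr mulmxBr !mul_delta_mx_cond.
by case: eqP => _; rewrite ?(mulr1n, mulr0n, scale1r, scale0r)
  ?(subrr, scaler0, addr0).
Qed.

Lemma autL1M c k c' k' :
  autL1 c k *m autL1 c' k' = autL1 (c + k * c') (k * k').
Proof.
rewrite /autL1 mulmxDl mul1mx mulmxDr mulmx1 derL1M derL1Z derL1D.
rewrite -[LHS]addrA derL1D.
by congr (_ + derL1 _ _); ring.
Qed.

Lemma autL1_1 : autL1 0 1 = 1%:M.
Proof. by rewrite /autL1 /derL1 subrr !scale0r !addr0. Qed.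

Lemma autL1K c k : k != 0 -> autL1 c k *m autL1 (- (k^-1 * c)) k^-1 = 1%:M.
Proof. by move=> k0; rewrite autL1M -autL1_1 mulrN mulVKf // subrr divff. Qed.

(** When k = 0, the matrix kills z. *)
Lemma autL1_unit c k : (autL1 c k \in unitmx) = (k != 0).
Proof.
apply/idP/idP => [u|/(autL1K c)/mulmx1_unit[]//].
apply/eqP => k0; have := mulKmx u (derL1 0 1).
rewrite {2}/autL1 mulmxDl mul1mx derL1M derL1Z derL1D k0.
rewrite (_ : derL1 _ _ = 0) ?mulmx0; last first.
  by rewrite /derL1 (_ : 1 + _ = 0) ?mulr0 ?addr0 ?scale0r ?addr0//; ring.
move=> /matrixP/(_ i2 i2); rewrite !mxE /= => /eqP.
by rewrite !(mulr0n,mulr1n,mul0r,add0r,mulr1) eq_sym oner_eq0.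
Qed.

Lemma invmx_autL1 c k :
  k != 0 -> invmx (autL1 c k) = autL1 (- (k^-1 * c)) k^-1.
Proof.
move=> k0; have u : autL1 c k \in unitmx by rewrite autL1_unit.
by rewrite -[RHS](mulKmx u) autL1K// mulmx1.
Qed.

Lemma mul_mx_col3 M (u : 'cV[K]_3) i :
  (M *m u) i 0 = M i i0 * u i0 0 + M i i1 * u i1 0 + M i i2 * u i2 0.
Proof. by rewrite mxE big_ord3. Qed.

Lemma L1_basis_nth (j : 'I_3) : (L1_basis K)`_j = delta_mx j 0 :> 'cV[K]_3.
Proof. by elim/ord3P: j. Qed.

Lemma coord_L1 i (v : L1 K) : coord (L1_basis K) i v = (v : 'cV[K]_3) i 0.
Proof.
have -> : v = \sum_j (v : 'cV[K]_3) j 0 *: (L1_basis K)`_j.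
  rewrite {1}[v](matrix_sum_delta (v : 'cV[K]_3)).
  by apply: eq_bigr => j _; rewrite big_ord1 L1_basis_nth.
rewrite coord_sum_free ?(basis_free (L1_basisP K))//.
rewrite summxE (bigD1 i)//= big1 => [|j ji].
  by rewrite L1_basis_nth !mxE !eqxx mulr1 addr0.
by rewrite L1_basis_nth !mxE eq_sym (negbTE ji) mulr0.
Qed.

Lemma mx_of_L1 (f : 'End(L1 K)) (v : 'cV[K]_3) :
  f v = mx_of (L1_basis K) f *m v :> 'cV[K]_3.
Proof.
apply/matrixP => i o; rewrite (ord1 o) mxE.
rewrite [v in LHS]matrix_sum_delta linear_sum summxE.
apply: eq_bigr => j _; rewrite big_ord1 linearZ !mxE coord_L1 mulrC.
by rewrite L1_basis_nth.
Qed.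

Definition L1_end M : 'End(L1 K) := linfun (mulmx M : L1 K -> L1 K).

Lemma L1_endE M (v : L1 K) : L1_end M v = M *m (v : 'cV[K]_3).
Proof. by rewrite lfunE. Qed.

Lemma mx_of_L1_end M : mx_of (L1_basis K) (L1_end M) = M.
Proof.
by apply/matrixP => i j; rewrite mxE coord_L1 L1_endE L1_basis_nth -colE mxE.
Qed.

(** Every matrix is the matrix of an endomorphism, so that the images under
    [mx_of] in the definitions of [Der_mx] and [Aut_mx] can be computed by
    testing the matrices themselves. *)
Lemma mx_of_L1_image (P : set 'End(L1 K)) (Q : set 'M[K]_3) :
  (forall M, P (L1_end M) <-> Q M) -> mx_of (L1_basis K) @` P = Q.
Proof.
move=> PQ; apply/seteqP; split => [_ [f Pf <-]|M QM].
  apply/PQ; rewrite (_ : L1_end _ = f) //.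
  by apply/lfunP => v; rewrite L1_endE mx_of_L1.
by exists (L1_end M); [apply/PQ | exact: mx_of_L1_end].
Qed.

Lemma derL1E c k (u : 'cV[K]_3) :
  ((derL1 c k *m u) i0 0 = 0) * ((derL1 c k *m u) i1 0 = 0) *
  ((derL1 c k *m u) i2 0 = c * (u i0 0 - u i1 0) + k * u i2 0).
Proof.
by split; [split|]; rewrite mul_mx_col3 !mxE /= ?(mulr1n, mulr0n); ring.
Qed.

Lemma autL1E c k (u : 'cV[K]_3) :
  ((autL1 c k *m u) i0 0 = u i0 0) * ((autL1 c k *m u) i1 0 = u i1 0) *
  ((autL1 c k *m u) i2 0 = c * (u i0 0 - u i1 0) + k * u i2 0).
Proof.
rewrite mulmxDl mul1mx.
by split; [split|]; rewrite mxE derL1E; ring.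
Qed.

Lemma derL1_eq M :
  M i0 i0 = 0 -> M i0 i1 = 0 -> M i0 i2 = 0 ->
  M i1 i0 = 0 -> M i1 i1 = 0 -> M i1 i2 = 0 -> M i2 i1 = - M i2 i0 ->
  M = derL1 (M i2 i0) (M i2 i2).
Proof.
move=> e00 e01 e02 e10 e11 e12 e21.
apply/matrixP => i; apply: ord3P; elim/ord3P: i;
  rewrite ?(e00, e01, e02, e10, e11, e12, e21) !mxE /= ?(mulr1n, mulr0n); ring.
Qed.

Lemma autL1_eq M :
  M i0 i0 = 1 -> M i0 i1 = 0 -> M i0 i2 = 0 ->
  M i1 i0 = 0 -> M i1 i1 = 1 -> M i1 i2 = 0 -> M i2 i1 = - M i2 i0 ->
  M = autL1 (M i2 i0) (M i2 i2).
Proof.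
move=> e00 e01 e02 e10 e11 e12 e21.
apply/matrixP => i; apply: ord3P; elim/ord3P: i;
  rewrite ?(e00, e01, e02, e10, e11, e12, e21) !mxE /= ?(mulr1n, mulr0n); ring.
Qed.

Lemma bracket_L1 (u v : L1 K) : bracket u v = L1_bracket u v.
Proof. by []. Qed.

Lemma L1_bracketE (u v : 'cV[K]_3) :
  (L1_bracket u v i0 0 = 0) *
  (L1_bracket u v i1 0 = u i0 0 * v i1 0 - u i1 0 * v i0 0) *
  (L1_bracket u v i2 0 = u i1 0 * v i2 0 - u i2 0 * v i1 0).
Proof. by split; [split|]; rewrite !mxE /= ?(mulr1n, mulr0n); ring. Qed.

(** The derivation rule on the pairs (x, y), (y, z) and (x, z) gives the linear
    equations that characterize [derL1]. *)
Lemma Der_L1 : Der_mx (L1_basis K) = [set derL1 p.1 p.2 | p in setT].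
Proof.
apply: mx_of_L1_image => M; split => [dM|[[c k] _ <-] u v].
  have E u v i : (M *m L1_bracket u v) i 0 =
      (L1_bracket (M *m u) v) i 0 + (L1_bracket u (M *m v)) i 0.
    have := dM u v; rewrite !L1_endE => /(congr1 (fun w : 'cV_3 => w i 0)) ->.
    by rewrite mxE.
  move: (E (L1_x K) (L1_y K)) (E (L1_y K) (L1_z K)) (E (L1_x K) (L1_z K)).
  move=> Exy Eyz Exz.
  move: (Exy i0) (Exy i1) (Exy i2) (Eyz i0) (Eyz i1) (Eyz i2).
  move: (Exz i0) (Exz i1) (Exz i2).
  rewrite !(mul_mx_col3, L1_bracketE, mxE) /=.
  rewrite ?(mulr1n, mulr0n, mulr0, mulr1, mul0r, mul1r,
    addr0, add0r, subr0, sub0r, oppr0).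
  move=> _ e12 e10 e01 e00 e21 e02 _ e11.
  exists (M i2 i0, M i2 i2) => //=; symmetry; apply: derL1_eq => //.
    by apply: (addIr (M i1 i1)); rewrite add0r.
  by apply: (addIr (M i2 i2)); rewrite add0r.
rewrite !L1_endE !bracket_L1; apply/matrixP => i o; rewrite (ord1 o) [RHS]mxE.
by elim/ord3P: i; rewrite !(L1_bracketE, derL1E) /=; ring.
Qed.

(** The homomorphism rule on pairs of basis vectors first gives z as an
    eigenvector, whose eigenvalue is nonzero by injectivity; once it is
    cancelled, the remaining equations make the first two rows those of the
    identity. *)
Lemma Aut_L1 : Aut_mx (L1_basis K) = autL1_set.
Proof.
apply: mx_of_L1_image => M; split => [[/bij_inj injM aM]|[[c k] /= k0 <-]].
  have E u v i : (M *m L1_bracket u v) i 0 = (L1_bracket (M *m u) (M *m v)) i 0.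
    have := aM u v; rewrite !L1_endE.
    by move/(congr1 (fun w : 'cV_3 => w i 0)) => ->.
  move: (E (L1_x K) (L1_y K)) (E (L1_y K) (L1_z K)) (E (L1_x K) (L1_z K)).
  move=> Exy Eyz Exz.
  move: (Exy i0) (Exy i1) (Exy i2) (Eyz i0) (Eyz i1) (Eyz i2).
  move: (Exz i0) (Exz i1) (Exz i2).
  rewrite !(mul_mx_col3, L1_bracketE, mxE) /=.
  rewrite ?(mulr1n, mulr0n, mulr0, mulr1, mul0r, mul1r,
    addr0, add0r, subr0, sub0r, oppr0).
  move=> _ _ e10 e01 e11 e21 e02 e12 e22.
  have {}e12 : M i1 i2 = 0 by rewrite e12 e01 e02 mul0r mulr0 subrr.
  have k0 : M i2 i2 != 0.
    apply/eqP => k0; have : L1_z K = 0 :> 'cV[K]_3.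
      apply: injM; rewrite !L1_endE mulmx0; apply/matrixP => i o.
      rewrite (ord1 o) mul_mx_col3 !mxE /= ?(mulr1n, mulr0n).
      by elim/ord3P: i; rewrite ?(e02, e12, k0) !mulr0 ?mul0r ?addr0.
    by move/matrixP/(_ i2 0)/eqP; rewrite !mxE /= oner_eq0.
  have {}e11 : M i1 i1 = 1 /\ M i1 i1 = M i0 i0 * M i1 i1.
    split; last by rewrite {1}e11 e01 mulr0 subr0.
    by apply: (mulIf k0); rewrite mul1r {2}e22 e12 mulr0 subr0.
  case: e11 => e11; rewrite e11 mulr1 => e00.
  have {}e10 : M i1 i0 = 0.
    move/esym/eqP: e10; rewrite e12 mulr0 subr0 mulf_eq0 (negbTE k0) orbF.
    by move/eqP.
  have {}e21 : M i2 i1 = - M i2 i0 by rewrite e21 e10 e11 mul0r mulr1 sub0r.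
  exists (M i2 i0, M i2 i2) => //=; symmetry; exact: autL1_eq.
split.
  exists (L1_end (autL1 (- (k^-1 * c)) k^-1)) => v; rewrite !L1_endE mulmxA.
    by rewrite autL1M addNr mulVf// autL1_1 mul1mx.
  by rewrite autL1K// mul1mx.
move=> u v.
rewrite !L1_endE !bracket_L1; apply/matrixP => i o; rewrite (ord1 o).
by elim/ord3P: i; rewrite !(L1_bracketE, autL1E) /=; ring.
Qed.

End Algebra.

(** * Closedness and solubility *)

Section Group.
Variable K : numFieldType.

Lemma subgroup_set1 n : subgroup_GL [set 1%:M : 'M[K]_n].
Proof.
split=> [_ ->|//|A B -> ->|A ->]; first exact: unitmx1.
  by rewrite mulmx1.
by rewrite invmx1.
Qed.

Lemma derived_sub n (G H : set 'M[K]_n) :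
  subgroup_GL H -> commutators G `<=` H -> derived_subgroup G `<=` H.
Proof. exact: smallest_sub. Qed.

Lemma derived_1 n (G : set 'M[K]_n) :
  commutators G `<=` [set 1%:M] -> derived_subgroup G = [set 1%:M].
Proof.
move=> cG; apply/seteqP; split; first exact: derived_sub (subgroup_set1 n) cG.
by move=> _ -> H [[]].
Qed.

(** The automorphisms with k = 1 form an abelian group that contains all
    commutators. *)
Definition shearL1 : set 'M[K]_3 := range (fun c => autL1 c 1).

Lemma subgroup_autL1 : subgroup_GL (@autL1_set K).
Proof.
split=> [_ [[c k] k0 <-]||_ _ [[c k] /= k0 <-] [[c' k'] /= k0' <-]|
  _ [[c k] /= k0 <-]].
- by rewrite /GL /= autL1_unit.
- by exists (0, 1); rewrite /= ?autL1_1// oner_neq0.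
- by rewrite autL1M; exists (c + k * c', k * k') => //=; rewrite mulf_neq0.
- rewrite invmx_autL1//.
  by exists (- (k^-1 * c), k^-1) => //=; rewrite invr_neq0.
Qed.

Lemma subgroup_shearL1 : subgroup_GL shearL1.
Proof.
split=> [_ [c _ <-]||_ _ [c _ <-] [c' _ <-]|_ [c _ <-]].
- by rewrite /GL /= autL1_unit oner_neq0.
- by exists 0; rewrite ?autL1_1.
- by rewrite autL1M mul1r mulr1; exists (c + c').
- by rewrite invmx_autL1 ?oner_neq0// invr1 mul1r; exists (- c).
Qed.

Lemma soluble_autL1 : soluble (@autL1_set K).
Proof.
exists 2%N => /=; apply: derived_1.
have dS : derived_subgroup (@autL1_set K) `<=` shearL1.
  apply: derived_sub subgroup_shearL1 _.
  move=> _ [_ [[c k] /= k0 <-] [_ [[c' k'] /= k0' <-] <-]].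
  rewrite !invmx_autL1// !autL1M.
  by rewrite (_ : k * k' / k / k' = 1); [eexists | field; apply/andP].
move=> _ [_ /dS[c _ <-] [_ /dS[c' _ <-] <-]] /=.
rewrite !invmx_autL1 ?oner_neq0// !autL1M -autL1_1 invr1 !mul1r.
by congr autL1; ring.
Qed.

Lemma cvg_autL1 (T : Type) (F : set_system T) (FF : Filter F)
    (f g : T -> K) (c k : K) :
  f @ F --> c -> g @ F --> k -> autL1 (f t) (g t) @[t --> F] --> autL1 c k.
Proof.
move=> fc gk; apply: cvgD; first exact: cvg_cst.
apply: cvgD; apply: cvgZr_tmp => //.
by apply: cvgB => //; exact: cvg_cst.
Qed.

(** The matrices of the form [autL1 c k] are the fixed points of the continuous
    map that rebuilds such a matrix from two entries of the third row. *)
Lemma autL1_Lie : matrix_Lie_group (@autL1_set K).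
Proof.
split; first exact: subgroup_autL1.
pose f (M : 'M[K]_3) := M - autL1 (M i2 i0) (M i2 i2).
exists (f @^-1` [set 0]).
  apply: (continuous_closedP f).1.
    move=> M; apply: (cvgB cvg_id (cvg_autL1 (nbhs_filter M) _ _));
      exact: coord_continuous.
  exact: accessible_closed_set1 (hausdorff_accessible (@norm_hausdorff _ _)) _.
apply/seteqP; split => [_ [[c k] k0 <-]|M [uM /subr0_eq EM]].
  split; first by rewrite /GL /= autL1_unit.
  apply/eqP; rewrite subr_eq0; apply/eqP.
  by rewrite /= !mxE /= ?(mulr1n, mulr0n); congr autL1; ring.
exists (M i2 i0, M i2 i2) => //=.
by rewrite -(autL1_unit (M i2 i0)) -EM.
Qed.

End Group.

(** * The complex exponential *)

(** Undoing the expected growth and rotation, e ^ (- u x) times the rotation of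
    (f, g) by the angle - v x has derivative zero and keeps its value. *)
Lemma rotation_scaling_ode (R : realType) (u v : R) (f g : R -> R) :
  (forall x, is_derive x (1 : R) f (u * f x - v * g x)) ->
  (forall x, is_derive x (1 : R) g (v * f x + u * g x)) ->
  f 0 = 1 -> g 0 = 0 ->
  f 1 = expR u * cos v /\ g 1 = expR u * sin v.
Proof.
move=> df dg f0 g0.
pose E := expR \o ( *%R (- u)).
pose C := @cos R \o ( *%R v); pose S := @sin R \o ( *%R v).
have dl w x : is_derive x (1 : R) ( *%R w) w.
  have := is_deriveZ w (is_derive_id x (1 : R)).
  by rewrite /GRing.scale /= mulr1.
have dE x : is_derive x (1 : R) E (expR (- u * x) * - u).
  exact: is_derive1_comp (is_derive_expR _) (dl _ _).
have dC x : is_derive x (1 : R) C (- sin (v * x) * v).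
  exact: is_derive1_comp (is_derive_cos _) (dl _ _).
have dS x : is_derive x (1 : R) S (cos (v * x) * v).
  exact: is_derive1_comp (is_derive_sin _) (dl _ _).
have P1 : (E * (f * C + g * S)) 1 = (E * (f * C + g * S)) 0.
  apply: is_derive_0_is_cst => x.
  have := is_deriveM (dE x)
    (is_deriveD (is_deriveM (df x) (dC x)) (is_deriveM (dg x) (dS x))).
  move/is_derive_eq; apply; rewrite /GRing.scale /= !fctE /C /S /E /=; ring.
have Q1 : (E * (g * C - f * S)) 1 = (E * (g * C - f * S)) 0.
  apply: is_derive_0_is_cst => x.
  have := is_deriveM (dE x)
    (is_deriveB (is_deriveM (dg x) (dC x)) (is_deriveM (df x) (dS x))).
  move/is_derive_eq; apply; rewrite /GRing.scale /= !fctE /C /S /E /=; ring.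
move: P1 Q1; rewrite !fctE /E /C /S /= !mulr1 !mulr0 f0 g0 expR0 cos0 sin0.
rewrite !(mul0r, mul1r, mulr0, mulr1, subr0, addr0) expRN => P1 Q1.
have e0 : expR u != 0 by rewrite gt_eqF ?expR_gt0.
have {}P1 : f 1 * cos v + g 1 * sin v = expR u.
  by apply: (mulfI (invr_neq0 e0)); rewrite P1 mulVf.
have {}Q1 : g 1 * cos v - f 1 * sin v = 0.
  by apply: (mulfI (invr_neq0 e0)); rewrite Q1 mulr0.
split.
  transitivity (f 1 * (cos v ^+ 2 + sin v ^+ 2)).
    by rewrite cos2Dsin2 mulr1.
  transitivity ((f 1 * cos v + g 1 * sin v) * cos v
    - (g 1 * cos v - f 1 * sin v) * sin v); first by ring.
  by rewrite P1 Q1 mul0r subr0.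
transitivity (g 1 * (cos v ^+ 2 + sin v ^+ 2)).
    by rewrite cos2Dsin2 mulr1.
transitivity ((f 1 * cos v + g 1 * sin v) * sin v
  + (g 1 * cos v - f 1 * sin v) * cos v); first by ring.
by rewrite P1 Q1 mul0r addr0.
Qed.

Section Egf.
Variable R : realType.
Implicit Types (c : R^nat) (x : R).

(** The exponential generating function of the sequence [c]. *)
Definition egf c x := limn (pseries (fun k => c k / k`!%:R) x).

(** This growth condition, stable under [shiftS], makes the exponential
    generating function an everywhere convergent power series. *)
Definition geo_bounded c := exists C M : R, forall k, `|c k| <= C * M ^+ k.

Definition shiftS c : R^nat := fun k => c k.+1.

Lemma geo_boundedS c : geo_bounded c -> geo_bounded (shiftS c).
Proof.
by case=> C [M cM]; exists (C * M), M => k; rewrite -mulrA -exprS; exact: cM.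
Qed.

Lemma egf_cvg c x : geo_bounded c -> cvgn (pseries (fun k => c k / k`!%:R) x).
Proof.
case=> C [M cM]; apply: normed_cvg; rewrite /normed_series_of /=.
apply: (@series_le_cvg _ _ (fun k => C * exp_coeff (M * `|x|) k)) => [n|n|n|].
- exact: normr_ge0.
- rewrite /exp_coeff /= exprMn mulrA mulr_ge0 ?invr_ge0 ?ler0n//.
  by rewrite mulrA mulr_ge0 ?exprn_ge0//; exact: le_trans (cM n).
- rewrite /exp_coeff /= exprMn !normrM normrX normfV normr_nat.
  rewrite mulrAC !mulrA ler_wpM2r ?invr_ge0 ?ler0n//.
  by rewrite ler_wpM2r ?exprn_ge0.
- exact/is_cvg_seriesZ/is_cvg_series_exp_coeff.
Qed.

Lemma pseries_diffs_egf c :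
  pseries_diffs (fun k => c k / k`!%:R) = (fun k => shiftS c k / k`!%:R).
Proof.
apply/funext => k; rewrite /pseries_diffs factS natrM invfM mulrCA mulVKf//.
Qed.

(** Term by term differentiation: the factorials turn the derivative into a
    shift of the sequence. *)
Lemma is_derive_egf c x :
  geo_bounded c -> is_derive x 1 (egf c) (egf (shiftS c) x).
Proof.
move=> cb; rewrite /egf -pseries_diffs_egf.
apply: (@pseries_snd_diffs _ _ (`|x| + 1)).
- exact: egf_cvg.
- by rewrite pseries_diffs_egf; exact/egf_cvg/geo_boundedS.
- by rewrite !pseries_diffs_egf; exact/egf_cvg/geo_boundedS/geo_boundedS.
- by rewrite (@ger0_norm _ (_ + _)) ?addr_ge0// ltrDl.
Qed.

Lemma egf_lin a b c d x : geo_bounded c -> geo_bounded d ->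
  egf (fun k => a * c k + b * d k) x = a * egf c x + b * egf d x.
Proof.
move=> cb db; rewrite /egf; apply/cvg_lim => //.
rewrite (_ : pseries _ x = a *: pseries (fun k => c k / k`!%:R) x +
   b *: pseries (fun k => d k / k`!%:R) x); last first.
  apply/funext => n; rewrite /pseries /series /= !fctE /GRing.scale /=.
  rewrite !mulr_sumr -big_split /=.
  by apply: eq_bigr => k _; ring.
by apply: cvgD; apply: cvgZl_tmp; exact: egf_cvg.
Qed.

Lemma egf0 c : egf c 0 = c 0%N.
Proof.
apply/cvg_lim => //; apply: cvg_near_cst; exists 1%N => // -[//|n] _.
rewrite /pseries /series /= big_nat_recl//= big1 => [|i _].
  by rewrite fact0 divr1 mulr1 addr0.
by rewrite exprS mul0r mulr0.
Qed.

Variables u v : R.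
Let l : R[i] := Complex u v.
Let a k := complex.Re (l ^+ k).
Let b k := complex.Im (l ^+ k).

Lemma Re_exprS k : a k.+1 = u * a k - v * b k.
Proof. by rewrite /a /b exprS; case: (l ^+ k) => ? ?. Qed.

Lemma Im_exprS k : b k.+1 = v * a k + u * b k.
Proof. by rewrite /a /b exprS addrC; case: (l ^+ k) => ? ?. Qed.

Lemma expr_complex_bounded k :
  `|a k| <= 1 * (`|u| + `|v|) ^+ k /\ `|b k| <= 1 * (`|u| + `|v|) ^+ k.
Proof.
elim: k => [|k []]; first by rewrite /a /b !expr0 /= normr1 normr0 mulr1 ler01.
rewrite Re_exprS Im_exprS !mul1r !exprS => ak bk; split.
  rewrite (le_trans (ler_normB _ _))// !normrM mulrDl.
  by rewrite lerD ?ler_wpM2l.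
rewrite (le_trans (ler_normD _ _))// !normrM mulrDl addrC.
by rewrite lerD ?ler_wpM2l.
Qed.

(** The recurrence l ^ (k + 1) = l * l ^ k, split into real and imaginary parts,
    turns the rule for derivatives of generating functions into the linear
    differential system of [rotation_scaling_ode]. *)
Lemma egf_expr_complex :
  [/\ geo_bounded a, geo_bounded b,
      egf a 1 = expR u * cos v & egf b 1 = expR u * sin v].
Proof.
have ab : geo_bounded a.
  by exists 1, (`|u| + `|v|) => k; case: (expr_complex_bounded k).
have bb : geo_bounded b.
  by exists 1, (`|u| + `|v|) => k; case: (expr_complex_bounded k).
have da x : is_derive x 1 (egf a) (u * egf a x - v * egf b x).
  rewrite -mulNr -egf_lin//.
  rewrite (_ : (fun k => _) = shiftS a); first exact: is_derive_egf.
  by apply/funext => k; rewrite /shiftS Re_exprS mulNr.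
have db x : is_derive x 1 (egf b) (v * egf a x + u * egf b x).
  rewrite -egf_lin//.
  rewrite (_ : (fun k => _) = shiftS b); first exact: is_derive_egf.
  by apply/funext => k; rewrite /shiftS Im_exprS.
by split => //; have [] := rotation_scaling_ode da db (egf0 a) (egf0 b).
Qed.
End Egf.

Section Complex.
Variable R : realType.
Local Notation Cx := (complex R : numFieldType).

Lemma real_complex_continuous : continuous (fun x : R => x%:C%C : Cx).
Proof.
move=> x; apply/cvgrPdist_lt => /= e e0.
have [eE e0'] : e = (complex.Re e)%:C%C /\ 0 < complex.Re e.
  by case: e e0 => r s; rewrite ltcE /= => /andP[/eqP -> ->].
have /cvgrPdist_lt/(_ _ e0') : (y : R) @[y --> x] --> x by exact: cvg_id.
apply: filterS => y.
rewrite eE -raddfB /= normc_def /= expr0n /= addr0 sqrtr_sqr.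
by rewrite ltcR.
Qed.

Lemma cvg_complex (T : Type) (F : set_system T) (FF : Filter F)
    (f g : T -> R) (a b : R) :
  f @ F --> a -> g @ F --> b ->
  (f t +i* g t)%C @[t --> F] --> (a +i* b : Cx)%C.
Proof.
move=> fa gb.
have E x y : (x +i* y : Cx)%C = x%:C%C + 'i%C * y%:C%C.
  apply/eqP; rewrite eq_complex /=.
  by rewrite !(mul0r, mul1r, mulr0, add0r, addr0, subr0, subrr) !eqxx.
under eq_fun do rewrite E.
have fa' := cvg_comp _ _ fa (@real_complex_continuous a).
have gb' := cvg_comp _ _ gb (@real_complex_continuous b).
rewrite E; exact: (cvgD fa' (cvgM (cvg_cst ('i%C : Cx)) gb')).
Qed.

Definition cexp (l : Cx) : Cx :=
  let: (u +i* v)%C := l in (expR u * cos v +i* (expR u * sin v))%C.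

Lemma cexp_series (l : Cx) :
  series (fun k => l ^+ k / k`!%:R) @ \oo --> cexp l.
Proof.
case: l => u v /=; have [ab bb ea eb] := egf_expr_complex u v.
have ca := @egf_cvg _ _ 1 ab; have cb := @egf_cvg _ _ 1 bb.
have := cvg_complex _ ca cb; rewrite -/(egf _ _) -/(egf _ _) ea eb => h.
set p := pseries _ _ in h; set q := pseries _ _ in h.
suff -> : series (fun k => (u +i* v : Cx)%C ^+ k / k`!%:R) =
    (fun n => (p n +i* q n)%C) by exact: h.
apply/funext => n; rewrite /p /q /pseries /series /=.
apply/eqP; rewrite eq_complex /=.
rewrite !raddf_sum /=; apply/andP; split; apply/eqP; apply: eq_bigr => k _;
  rewrite -(rmorph_nat (@real_complex R)) -fmorphV expr1n mulr1;
  by case: (_ ^+ k) => ? ?; rewrite /= mulr0 ?subr0 ?add0r.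
Qed.

Lemma cexp_neq0 l : cexp l != 0.
Proof.
case: l => u v; have /negbTE e0 : expR u != 0 by rewrite gt_eqF ?expR_gt0.
rewrite eq_complex /= !mulf_eq0 e0 /=; apply/negP => /andP[] /eqP c0 /eqP s0.
have := cos2Dsin2 v; rewrite c0 s0 expr0n /= addr0 => /eqP.
by rewrite eq_sym oner_eq0.
Qed.

(** The arccosine of x has sine |y|; the sign of y decides between this angle
    and its opposite. *)
Lemma polar_angle (x y : R) : x ^+ 2 + y ^+ 2 = 1 ->
  exists t, cos t = x /\ sin t = y.
Proof.
move=> xy.
have x1 : -1 <= x <= 1.
  rewrite -ler_norml -(@expr_le1 _ 2)// real_normK ?num_real//.
  by rewrite -xy lerDl sqr_ge0.
have sy : Num.sqrt (1 - x ^+ 2) = `|y|.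
  by rewrite -xy addrAC subrr add0r sqrtr_sqr.
case: (leP 0 y) => y0.
  by exists (acos x); rewrite acosK// sin_acos// sy ger0_norm.
by exists (- acos x); rewrite cosN sinN acosK// sin_acos// sy ltr0_norm// opprK.
Qed.

Lemma cexp_surj z : z != 0 -> exists l, cexp l = z.
Proof.
case: z => x y z0; pose r := Num.sqrt (x ^+ 2 + y ^+ 2).
have r0 : 0 < r.
  rewrite sqrtr_gt0 lt0r addr_ge0 ?sqr_ge0// andbT paddr_eq0 ?sqr_ge0//.
  by rewrite !sqrf_eq0; move: z0; rewrite eq_complex.
have rn0 : r != 0 by rewrite gt_eqF.
have [|t [ct st]] := @polar_angle (x / r) (y / r).
  rewrite !expr_div_n -mulrDl sqr_sqrtr ?addr_ge0 ?sqr_ge0// divff//.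
  by rewrite -(@sqr_sqrtr _ (_ + _)) ?addr_ge0 ?sqr_ge0// sqrf_eq0.
exists (ln r +i* t)%C; rewrite /= lnK ?posrE// ct st.
by rewrite ![r * _]mulrC !divfK.
Qed.

(** * The exponential of the derivations *)

Lemma cexp0 : cexp (0 : Cx) = 1.
Proof. by rewrite /= expR0 cos0 sin0 mulr1 mulr0. Qed.

(** The entire function (e ^ k - 1) / k, with the value 1 at its removable
    singularity 0. *)
Definition expm1_quot (k : Cx) : Cx := if k == 0 then 1 else (cexp k - 1) / k.

Lemma expm1_quotE k : expm1_quot k * k = cexp k - 1.
Proof.
rewrite /expm1_quot; case: eqP => [->|/eqP k0]; last by rewrite divfK.
by rewrite mulr0 cexp0 subrr.
Qed.

Lemma expm1_quot_series (k : Cx) :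
  series (fun j => k ^+ j / j.+1`!%:R) @ \oo --> expm1_quot k.
Proof.
rewrite /expm1_quot; case: eqP => [->|/eqP k0].
  apply: cvg_near_cst; exists 1%N => // -[//|n] _.
  rewrite /series /= big_nat_recl//= big1 => [|i _].
    by rewrite expr0 divr1 addr0.
  by rewrite exprS !mul0r.
have h := @cexp_series k; rewrite -cvg_shiftS in h.
have E : series (fun j => k ^+ j / j.+1`!%:R) =
    (fun n => (series (fun j => k ^+ j / j`!%:R) n.+1 - 1) * k^-1).
  apply/funext => n; rewrite /series /= big_nat_recl//= fact0 divr1.
  rewrite addrAC subrr add0r mulr_suml; apply: eq_bigr => j _.
  by rewrite exprS mulrAC [k * _]mulrC mulfK.
rewrite E; exact: (cvgM (cvgB h (cvg_cst (1 : Cx))) (cvg_cst (k^-1 : Cx))).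
Qed.

(** The powers of such a matrix are k ^ j X, so that after its first term the
    exponential series is a scalar series times X. The scalar series, of general
    term k ^ j / (j + 1)!, has the sum [expm1_quot k]. *)
Lemma expmx_quasi_idem n (X : 'M[Cx]_n) (k : Cx) :
  X *m X = k *: X -> expmx X = 1%:M + expm1_quot k *: X.
Proof.
move=> XX; apply/cvg_lim; first exact: norm_hausdorff.
have XS j : X ^+ j.+1 = k ^+ j *: X.
  elim: j => [|j IH]; first by rewrite scale1r.
  by rewrite exprS IH -[X * _]scalemxAr XX scalerA -exprSr.
rewrite -cvg_shiftS.
have E : [sequence (series (fun j => j`!%:R^-1 *: X ^+ j)) m.+1]_m =
    (fun m => 1%:M + series (fun j => k ^+ j / j.+1`!%:R) m *: X).
  apply/funext => m; rewrite /series /= big_nat_recl//= fact0 invr1 scale1r.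
  rewrite scaler_suml; congr (_ + _); apply: eq_bigr => j _.
  by rewrite XS scalerA mulrC.
rewrite E.
have h1 := cvgZr_tmp (a := X) (@expm1_quot_series k).
exact: (cvgD (cvg_cst (1%:M : 'M[Cx]_n)) (h1 _)).
Qed.

Lemma expmx_derL1 c (k : Cx) :
  expmx (derL1 c k) = autL1 (expm1_quot k * c) (cexp k).
Proof.
by rewrite (expmx_quasi_idem (derL1M c k c k)) derL1Z expm1_quotE.
Qed.

(** A zero l of [expm1_quot] satisfies e ^ l = 1, so only the logarithm of 1 has
    to be chosen with care. *)
Lemma cexp_surj_quot (z : Cx) :
  z != 0 -> exists2 l, cexp l = z & expm1_quot l != 0.
Proof.
move=> z0; have [->|z1] := eqVneq z 1.
  by exists 0; [exact: cexp0|rewrite /expm1_quot eqxx oner_neq0].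
have [l lz] := cexp_surj z0; exists l => //.
by apply: contraNneq z1 => q0; rewrite -subr_eq0 -lz -expm1_quotE q0 mul0r.
Qed.

Lemma autL1_exp :
  @autL1_set Cx = [set expmx X | X in [set derL1 p.1 p.2 | p in setT]].
Proof.
apply/seteqP; split=> [_ [[c k] /= k0 <-]|_ [_ [[c k] _ <-] <-]] /=.
  have [l <- q0] := cexp_surj_quot k0.
  exists (derL1 (c / expm1_quot l) l); first by exists (c / expm1_quot l, l).
  by rewrite expmx_derL1 mulrC divfK.
exists (expm1_quot k * c, cexp k); last by rewrite expmx_derL1.
exact: cexp_neq0.
Qed.

Lemma segment_continuous (a b : R) : continuous (fun t : R => a + t * (b - a)).
Proof.
move=> t; apply: cvgD; first exact: cvg_cst.
by apply: cvgM; [exact: cvg_id|exact: cvg_cst].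
Qed.

(** A straight segment in the coordinate k could meet 0; the path interpolates
    logarithms instead. *)
Lemma path_connected_autL1 : path_connected R (@autL1_set Cx).
Proof.
move=> _ _ [[c k] /= k0 <-] [[c' k'] /= k0' <-].
have [[u v] luv] := cexp_surj k0; have [[u' v'] luv'] := cexp_surj k0'.
case: c c' => x y [x' y'].
pose s (a b t : R) : R := a + t * (b - a).
pose gamma (t : R) : 'M[Cx]_3 :=
  autL1 (s x x' t +i* s y y' t)%C (cexp (s u u' t +i* s v v' t)%C).
exists gamma; split => [||| t _].
- apply: continuous_subspaceT => t; apply: cvg_autL1.
    by apply: cvg_complex; exact: segment_continuous.
  apply: cvg_complex; apply: cvgM.
  + exact: (cvg_comp _ _ (@segment_continuous u u' t) (@continuous_expR R _)).
  + exact: (cvg_comp _ _ (@segment_continuous v v' t) (@continuous_cos R _)).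
  + exact: (cvg_comp _ _ (@segment_continuous u u' t) (@continuous_expR R _)).
  + exact: (cvg_comp _ _ (@segment_continuous v v' t) (@continuous_sin R _)).
- by rewrite /gamma /s !mul0r !addr0 luv.
- by rewrite /gamma /s !mul1r !(addrC _ (_ - _)) !subrK luv'.
- exists ((s x x' t +i* s y y' t)%C, cexp (s u u' t +i* s v v' t)%C) => //.
  exact: cexp_neq0.
Qed.

End Complex.

Theorem proposition4p1 (R : realType) :
  let Aut_L1 : set 'M[R[i]]_3 := Aut_mx (L1_basis R[i]) in
  let Der_L1 : set 'M[R[i]]_3 := Der_mx (L1_basis R[i]) in
  [/\ matrix_Lie_group Aut_L1,
      Aut_L1 = [set expmx X | X in Der_L1],
      path_connected R Aut_L1 &
      soluble Aut_L1].
Proof.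
move=> AutL1 DerL1; rewrite /AutL1 /DerL1 Aut_L1 Der_L1.
split.
- exact: autL1_Lie.
- exact: autL1_exp.
- exact: path_connected_autL1.
- exact: soluble_autL1.
Qed.
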